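(* Let $\varepsilon>0$ be fixed. There is $p_0(\varepsilon)$ such that the following holds for every prime $p>p_0(\varepsilon)$. Let $\mathcal{I}$ and $\mathcal{J}$ be nonzero intervals of $\mathbb{F}_p$ such that $$|\mathcal{I}|^2\cdot|\mathcal{J}|>p^{1+\varepsilon},\qquad |\mathcal{I}|\cdot|\mathcal{J}|^2>p^{1+\varepsilon}.$$ Then for every $\lambda\in\mathbb{F}_p$ the equation $$\sum_{i=1}^{8}\frac{x_i}{y_i}=\lambda$$ has a solution with $(x_1,\dots,x_8)\in\mathcal{I}^8$ and $(y_1,\dots,y_8)\in\mathcal{J}^8$ (with all $y_i\neq 0$).
   Context: $\mathbb{F}_p$ is the field of residues modulo the prime $p$. An interval of $\mathbb{F}_p$ is a set of the form $\{a,a+1,\dots,a+N-1\}$ (residues mod $p$) for some $a\in\mathbb{F}_p$ and integer $1\le N\le p$; it is called nonzero if it is not equal to $\{0\}$. $|\mathcal{X}|$ denotes cardinality. The fraction $x/y$ means $x\cdot y^{-1}$ in $\mathbb{F}_p$, so only $y\neq 0$ is allowed. Here $\varepsilon$ is a small fixed positive constant and $p$ is sufficiently large in terms of $\varepsilon$. *)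

(* Defs.v *)
From mathcomp Require Import all_boot all_order all_algebra.
From mathcomp Require Import reals exp.

Set Implicit Arguments.
Unset Strict Implicit.
Unset Printing Implicit Defensive.

Import GRing.Theory.
Local Open Scope ring_scope.

Definition Fp_interval (p : nat) (A : {set 'F_p}) : Prop :=
  exists (a : 'F_p) (N : nat),
    (1 <= N <= p)%N /\ A = [set a + (val k)%:R | k : 'I_N].

Definition nonzero_Fp_interval (p : nat) (A : {set 'F_p}) : Prop :=
  Fp_interval A /\ A <> [set 0].

(* Main.v *)
Require Import Defs.
From mathcomp Require Import all_boot all_order all_algebra all_field.
From mathcomp Require Import reals exp.
From mathcomp Require Import zify ring.

Set Implicit Arguments.
Unset Strict Implicit.
Unset Printing Implicit Defensive.

Import Order.TTheory GRing.Theory Num.Theory.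
Local Open Scope ring_scope.

(** Write X = |I| and Y = |J|. The factor p^eps is only used to absorb an
    absolute constant C, through C p < X^2 Y and C p < X Y^2.

    If X^8 > C p, eight fixed denominators suffice. Dirichlet's theorem applied
    to the centre b of J gives h b = +-u with h and u small; passing to a
    progression of step G in J, the denominators become (up to the factor
    +-G/h) integers z of an arithmetic progression of difference h, with
    c min(X, Y) < z < X / 16. Eight of them are pairwise coprime, and by the
    Chinese remainder theorem the integers sum_i s_i Z / z_i, where Z is the
    product of the z_i and 0 <= s_i < X, fill an interval of length p.

    Otherwise Y^4 > C p^3 and one fixed numerator suffices. For a != 0 the sum
    S(a) = sum_(j, d < n) psi (a / (b + j + d)) satisfies, by Cauchy-Schwarz in
    j, |S(a)|^2 <= n sum_(d, e) |G (a / (e - d))|, where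
    G(t) = sum_x psi (t (1/x - 1/(x+1))) has mean square at most 6 p. Hence
    |S(a)|^4 <= 6 n^5 p^2, and the circle method applies. *)

(** * Integers representing the denominators *)

Section PrimeField.
Variables (p : nat) (p_pr : prime p).

Lemma natf_Fp_neq0 (n : nat) : (0 < n < p)%N -> n%:R != 0 :> 'F_p.
Proof.
move=> /andP[n0 np]; apply/negP => /eqP /(congr1 val).
by rewrite /= val_Fp_nat // modn_small // => n_eq0; rewrite n_eq0 in n0.
Qed.

Lemma Fp_val_ltn (x : 'F_p) : (val x < p)%N.
Proof. by have := ltn_ord x; rewrite [X in (_ < X)%N]Fp_cast. Qed.

(** Pigeonhole: the residues of [i * b] for [0 <= i <= H] fall into [H] boxes of length [p / H]. The
    sign [s] records which of two residues sharing a box is larger. *)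
Lemma Fp_dirichlet (b : 'F_p) (H : nat) : (0 < H)%N ->
  exists h u : nat, exists s : 'F_p,
    [/\ (0 < h <= H)%N, (u * H < p)%N, s = 1 \/ s = -1 & h%:R * b = s * u%:R].
Proof.
move=> H0; have p0 := prime_gt0 p_pr.
pose r (i : 'I_H.+1) : nat := val ((i : nat)%:R * b : 'F_p).
have rlt i : (r i < p)%N by apply: Fp_val_ltn.
have boxlt i : ((r i * H) %/ p < H)%N.
  by rewrite ltn_divLR // mulnC ltn_pmul2l.
pose box i : 'I_H := Ordinal (boxlt i).
have : ~~ injectiveb box.
  apply/negP => /injectiveP /leq_card; rewrite !card_ord; lia.
case/injectivePn => i [j neq_ij /(congr1 val) /= eq_box].
have close k l : ((r k * H) %/ p = (r l * H) %/ p -> (r k - r l) * H < p)%N.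
  move=> e; have := ltn_ceil (r k * H) p0; have := leq_divM (r l * H) p.
  rewrite e mulnBl; nia.
wlog lt_ij : i j neq_ij eq_box / (i < j)%N.
  move=> wl; case: (ltngtP i j) => [lt_ij|lt_ji|eq_ij].
  - exact: (wl i j).
  - by apply: (wl j i) => //; rewrite eq_sym.
  - by case/eqP: neq_ij; apply: val_inj.
have rE k : (r k)%:R = (k : nat)%:R * b :> 'F_p by rewrite /r natr_Zp.
have hE : (j - i)%:R * b = (r j)%:R - (r i)%:R :> 'F_p.
  by rewrite natrB ?(ltnW lt_ij) // mulrBl !rE.
have hb : (0 < j - i <= H)%N by have := ltn_ord j; lia.
case: (leqP (r i) (r j)) => le_r.
  exists (j - i)%N, (r j - r i)%N, 1; split=> //; first exact: close.
    by left.
  by rewrite hE natrB // mul1r.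
exists (j - i)%N, (r i - r j)%N, (-1); split=> //; first exact: close.
  by right.
by rewrite hE natrB ?(ltnW le_r) // mulN1r opprB.
Qed.

(** The common factor [g] satisfies [g <= h <= H < p], so it can be cancelled in ['F_p]. *)
Lemma Fp_dirichlet_coprime (b : 'F_p) (H : nat) : (0 < H < p)%N ->
  exists h u : nat, exists s : 'F_p,
    [/\ (0 < h <= H)%N, coprime u h, (u * H < p)%N, s = 1 \/ s = -1
      & h%:R * b = s * u%:R].
Proof.
move=> /andP[H0 Hp]; have [h [u [s [/andP[h0 hH] uH s1 hE]]]] := Fp_dirichlet b H0.
set g := gcdn u h.
have g0 : (0 < g)%N by rewrite gcdn_gt0 h0 orbT.
have gh : (g %| h)%N := dvdn_gcdr u h.
have gu : (g %| u)%N := dvdn_gcdl u h.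
have gp : (g < p)%N by have := dvdn_leq h0 gh; lia.
exists (h %/ g)%N, (u %/ g)%N, s; split=> //.
- by rewrite divn_gt0 // dvdn_leq //= (leq_trans (leq_div _ _)).
- by rewrite /coprime -(eqn_pmul2r g0) muln_gcdl !divnK // mul1n.
- by apply: leq_ltn_trans uH; rewrite leq_mul // leq_div.
- have gF : g%:R != 0 :> 'F_p by apply: natf_Fp_neq0; rewrite g0.
  apply: (mulfI gF); rewrite mulrA mulrCA -!natrM ![(g * _)%N]mulnC.
  by rewrite !divnK.
Qed.

End PrimeField.

(** Take for [s] the part of [W] built from the primes not dividing [z]. A prime of [W] then divides
    exactly one of [z] and [s]; if it divides [z], it does not divide [h], so in no case does it
    divide [z + h * s]. *)
Lemma coprime_progression (W z h : nat) : (0 < W)%N -> (0 < z)%N -> coprime z h ->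
  exists2 s : nat, (s <= W)%N & coprime (z + h * s) W.
Proof.
move=> W0 z0 czh; exists (W`_(\pi(z)^'))%N.
  exact: dvdn_leq (dvdn_part _ _).
set s := (W`_(\pi(z)^'))%N.
rewrite /coprime; apply/negPn/negP => g1.
have g0 : (0 < gcdn (z + h * s) W)%N by rewrite gcdn_gt0 W0 orbT.
have [|q q_pr] := @pdivP (gcdn (z + h * s) W); first by move: g1 g0; lia.
rewrite dvdn_gcd => /andP[q1 qW].
have qs : (q %| s)%N = ~~ (q %| z)%N.
  have := pi_of_part (\pi(z)^') W0 q.
  rewrite -/s !inE !mem_primes q_pr W0 z0 qW part_gt0 /=.
  by [].
case: (boolP (q %| z)%N) qs => [qz /negbT qs|qz qs].
  move: q1; rewrite dvdn_addr // Euclid_dvdM // (negPf qs) orbF => qh.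
  have : (q %| gcdn z h)%N by rewrite dvdn_gcd qz.
  by rewrite (eqP czh) dvdn1 => /eqP q1; rewrite q1 in q_pr.
by move: q1; rewrite dvdn_addl ?(dvdn_mull _ qs) // (negPf qz).
Qed.

(** A common prime of two terms divides [h * W * (j - i)]. It does not divide [W], since every term
    is [z + h * s] modulo [W]; hence not [j - i], a divisor of [W]; and not [h], since [z] is
    coprime to [h]. *)
Lemma pairwise_coprime_progression (m W z h : nat) :
  (0 < W)%N -> (forall i, (0 < i < m)%N -> (i %| W)%N) ->
  (0 < z)%N -> coprime z h ->
  exists2 s : nat, (s <= W)%N &
    forall i j : nat, (i < j < m)%N ->
      coprime (z + h * (s + W * i)) (z + h * (s + W * j)).
Proof.
move=> W0 Wm z0 czh; have [s sW cW] := coprime_progression W0 z0 czh.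
exists s => // i j /andP[ij jm].
rewrite /coprime; apply/negPn/negP => g1.
set a := (z + _ * (_ + _ * i))%N in g1 *; set c := (z + _ * (_ + _ * j))%N in g1 *.
have a0 : (0 < a)%N by rewrite addn_gt0 z0.
have g0 : (0 < gcdn a c)%N by rewrite gcdn_gt0 a0.
have [|q q_pr] := @pdivP (gcdn a c); first by move: g1 g0; lia.
rewrite dvdn_gcd => /andP[qa qc].
have qNW : ~~ (q %| W)%N.
  apply/negP => qW; have : (q %| z + h * s)%N.
    by move: qa; rewrite /a mulnDr addnA dvdn_addl // mulnCA dvdn_mulr.
  move=> qz; have : (q %| gcdn (z + h * s) W)%N by rewrite dvdn_gcd qz.
  by rewrite (eqP cW) dvdn1 => /eqP e; rewrite e in q_pr.
have qNh : ~~ (q %| h)%N.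
  apply/negP => qh; have qz : (q %| z)%N.
    by move: qa; rewrite /a dvdn_addl // dvdn_mulr.
  have : (q %| gcdn z h)%N by rewrite dvdn_gcd qz.
  by rewrite (eqP czh) dvdn1 => /eqP e; rewrite e in q_pr.
have qNij : ~~ (q %| j - i)%N.
  apply/negP => qij; case/negP: qNW; apply: dvdn_trans qij _.
  by apply: Wm; lia.
have cE : c = (a + h * (W * (j - i)))%N.
  by rewrite /a /c mulnBr -addnA -mulnDr -addnA subnKC // leq_pmul2l // ltnW.
move: qc; rewrite cE dvdn_addr // Euclid_dvdM // Euclid_dvdM //.
by rewrite (negPf qNh) (negPf qNW) (negPf qNij).
Qed.

(** Chinese remaindering: with [Z] the product, [n] is the sum of the [s_i * (Z / z_i)] plus
    [q * Z]. Each term of the sum is below [Z], so the lower bound on [n] keeps [q] nonnegative. *)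
Lemma sum_fractions_repr (F : fieldType) (zs : seq nat) (n : nat) :
  pairwise coprime zs -> all (fun z : nat => z%:R != 0 :> F) zs ->
  (size zs * \prod_(z <- zs) z <= n)%N ->
  exists ss : seq nat, exists q : nat,
    [/\ forall i, (i < size zs)%N -> (nth 0 ss i < nth 0 zs i)%N,
        (q * \prod_(z <- zs) z <= n)%N
      & n%:R / (\prod_(z <- zs) z)%:R
        = \sum_(i < size zs) (nth 0%N ss i)%:R / (nth 0%N zs i)%:R + q%:R :> F].
Proof.
elim: zs n => [|z zs IH] n /=.
  move=> _ _ _; exists [::], n; split=> //.
    by rewrite big_nil muln1.
  by rewrite big_nil divr1 big_ord0 add0r.
move=> /andP[cz czs] /andP[zF zsF]; rewrite big_cons; set Z := \prod_(x <- zs) x.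
move=> le_n.
have z0 : (0 < z)%N by rewrite lt0n; apply: contraNneq zF => ->.
have Z0 : (0 < Z)%N.
  rewrite /Z; elim: (zs) zsF => [|y ys IHy] /=; first by rewrite big_nil.
  move=> /andP[yF ysF]; rewrite big_cons muln_gt0 IHy // andbT lt0n.
  by apply: contraNneq yF => ->.
have ZF : Z%:R != 0 :> F.
  rewrite /Z; elim: (zs) zsF => [|y ys IHy] /=; first by rewrite big_nil oner_eq0.
  by move=> /andP[yF ysF]; rewrite big_cons natrM mulf_neq0 // IHy.
have czZ : coprime z Z.
  rewrite /Z; elim: (zs) cz => [|y ys IHy] /=; first by rewrite big_nil coprimen1.
  by move=> /andP[zy zys]; rewrite big_cons coprimeMr zy IHy.
(* [chinese z Z n 0] is a multiple of [Z] congruent to [n] modulo [z]. *)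
have [s sz sE] : exists2 s, (s < z)%N & s * Z = n %[mod z].
  exists ((chinese z Z n 0 %/ Z) %% z)%N; first by rewrite ltn_mod.
  have Zc : (Z %| chinese z Z n 0)%N.
    by apply/eqP; have := chinese_modr czZ n 0; rewrite mod0n.
  by rewrite modnMml divnK // chinese_modl.
have le_sZ : (s * Z <= n)%N.
  apply: leq_trans le_n; rewrite mulSn -[(s * Z)%N]addn0 leq_add //.
  by rewrite leq_mul // ltnW.
have /dvdnP[n' n'E] : (z %| n - s * Z)%N by rewrite -eqn_mod_dvd // sE.
have nE : n = (s * Z + n' * z)%N by rewrite -n'E subnKC.
have [|ss [q [ss_lt q_le qE]]] := IH n' czs zsF.
  rewrite -/Z -(leq_pmul2r z0) -(leq_add2l (s * Z)) -nE.
  apply: leq_trans le_n; rewrite mulSn leq_add //.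
    by rewrite leq_mul2r (ltnW sz) orbT.
  by rewrite [(z * Z)%N]mulnC mulnA.
exists (s :: ss), q; split.
- by case=> [|i] //= /ss_lt.
- rewrite mulnCA mulnC nE; apply: leq_trans (leq_addl _ _).
  by rewrite leq_mul2r q_le orbT.
- rewrite big_ord_recl /= -addrA -qE -/Z nE natrD !natrM.
  by field; rewrite zF ZF.
Qed.

(* Choosing [G = 1 + h k] makes [- k] the inverse of [h] modulo [G], so the
   multiples of [G] among the [u + h t] are those with [t = u k] modulo [G]. *)
Lemma small_progression (h u X Y c : nat) :
  (0 < h)%N -> coprime u h -> (0 < X)%N -> (0 < c)%N ->
  (16 * c <= Y)%N -> (16 * c * h <= Y)%N -> (256 * c * u <= X * Y)%N ->
  (256 * c * h <= X)%N ->
  exists G t z : nat,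
    [/\ (0 < G <= Y)%N, (t + G * c <= Y)%N, (u + h * t = G * z)%N, coprime z h
      & forall s, (s <= c)%N ->
          (16 * (z + h * s) < X)%N /\ (minn X Y <= 64 * (z + h * s))%N].
Proof.
move=> h0 cuh X0 c0 hY1 hY2 hY3 hX.
(* [N] bounds [u + h * t] for [t <= Y]. The choice of [k] makes [G * X] exceed [16 * N] by at most
   [X + h * X], so these values divided by [G] fall below [X / 16]. *)
have [N NE] : exists N, N = (u + h * Y)%N by eexists.
have hX0 : (0 < h * X)%N by rewrite muln_gt0 h0.
have [k kE] : exists k, k = (16 * N %/ (h * X)).+1 by eexists.
have [G GE] : exists G, G = (1 + h * k)%N by eexists.
have [GX1 GX2] : (16 * N < G * X /\ G * X <= X + 16 * N + h * X)%N.
  have k1 := ltn_ceil (16 * N) hX0; have k2 := leq_divM (16 * N) (h * X).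
  rewrite -kE in k1; rewrite GE.
  have k3 : (k * (h * X) <= 16 * N + h * X)%N.
    by rewrite kE mulSn addnC leq_add2r.
  by split; lia.
have G0 : (0 < G)%N by rewrite GE.
have GY : (4 * c * G <= Y)%N.
  rewrite -(leq_pmul2r X0).
  have e0 : (c * (G * X) <= c * (X + 16 * N + h * X))%N by rewrite leq_mul2l GX2 orbT.
  have e1 : (16 * c * X <= Y * X)%N by rewrite leq_mul2r hY1 orbT.
  have e2 : (16 * c * h * X <= Y * X)%N by rewrite leq_mul2r hY2 orbT.
  have e3 : (256 * c * h * Y <= X * Y)%N by rewrite leq_mul2r hX orbT.
  rewrite NE in e0; lia.
(* Taking [t] in the upper half of [[0, Y]] keeps [u + h * t] at least [N / 2]. *)
have [B [B1 B2]] : exists B, (2 * B <= Y.+1)%N /\ (Y <= 2 * B)%N.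
  by exists (uphalf Y); have := odd_double_half Y; rewrite uphalf_half; lia.
(* [G.-1 * B] stands for [- B] modulo [G], so that [t = B + r] is [u * k] modulo [G]. *)
have [r rE] : exists r, r = ((u * k + G.-1 * B) %% G)%N by eexists.
have rG : (r < G)%N by rewrite rE ltn_mod.
have [t tE] : exists t, t = (B + r)%N by eexists.
have /dvdnP[z zE] : (G %| u + h * t)%N.
  have e : t = u * k %[mod G].
    by rewrite tE rE modnDmr addnCA -mulSn prednK // addnC [(G * B)%N]mulnC modnMDl.
  rewrite /dvdn -modnDmr -modnMmr e modnMmr modnDmr.
  have -> : (u + h * (u * k) = u * G)%N by rewrite GE; ring.
  by rewrite modnMl.
have cG : (G <= G * c)%N by rewrite leq_pmulr.
have tY : (t + G * c <= Y)%N by rewrite tE; lia.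
exists G, t, z; split=> //.
- by rewrite G0 /=; lia.
- by rewrite zE mulnC.
- have : coprime (u + h * t) h by rewrite coprime_sym /coprime addnC mulnC gcdnMDl -/(coprime h u) coprime_sym.
  by rewrite zE coprimeMl => /andP[].
move=> s sc; have [w wE] : exists w, w = (z + h * s)%N by eexists.
rewrite -wE.
have wG : (w * G = u + h * (t + G * s))%N by rewrite wE mulnDl -zE; ring.
have wN : (w * G <= N)%N.
  rewrite wG NE leq_add2l leq_mul2l; apply/orP; right.
  by apply: leq_trans tY; rewrite leq_add2l leq_mul2l sc orbT.
have wN2 : (N <= 2 * (w * G))%N.
  have : (h * Y <= h * (2 * B))%N by rewrite leq_mul2l B2 orbT.
  have : (h * B <= h * (t + G * s))%N.
    by rewrite leq_mul2l tE -addnA leq_addr orbT.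
  by rewrite wG NE; lia.
split.
  by rewrite -(ltn_pmul2r G0); lia.
have N0 : (0 < N)%N by rewrite NE addn_gt0 muln_gt0 h0; apply/orP; right; lia.
(* Either [G * X <= 32 * N] and [w] is compared with [X], or [G <= 4 * h] and [w] is compared with
   [Y], because [h * Y <= N]. *)
case: (leqP (h * X) (8 * N)) => cse.
  apply: leq_trans (geq_minl _ _) _.
  have GX3 : (G * X <= 32 * N)%N by have := leq_pmull X h0; lia.
  rewrite -(leq_pmul2r N0).
  have : (X * N <= X * (2 * (w * G)))%N by rewrite leq_mul2l wN2 orbT.
  have : (w * (G * X) <= w * (32 * N))%N by rewrite leq_mul2l GX3 orbT.
  by lia.
apply: leq_trans (geq_minr _ _) _.
have G4 : (G <= 4 * h)%N.
  by rewrite -(leq_pmul2r X0); have := leq_pmull X h0; lia.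
rewrite -(leq_pmul2r h0).
have : (w * G <= w * (4 * h))%N by rewrite leq_mul2l G4 orbT.
by rewrite NE in wN2; lia.
Qed.

(** With [y_i = s * G * w_i / h] and pairwise coprime [w_i], it remains to write an element [mu] as
    a sum of [k_i / w_i] with [0 <= k_i < X]. The denominators are centred at [b] because the sign
    [s] is not under control. *)
Lemma fractions_cover (p : nat) (p_pr : prime p) (a b : 'F_p) (W c X Y H : nat) :
  (0 < W)%N -> (forall i, (0 < i < 8)%N -> (i %| W)%N) -> c = (8 * W)%N ->
  (0 < H < p)%N -> (X <= p)%N -> (Y < p)%N -> (16 * c <= Y)%N -> (16 * c * H <= Y)%N ->
  (256 * c * H <= X)%N -> (256 * c * p <= X * Y * H)%N -> (4 * p <= H ^ 7 * X)%N ->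
  forall l : 'F_p, exists x y : 'I_8 -> 'F_p,
    [/\ forall i, exists2 k : nat, (k < X)%N & x i = a + k%:R,
        forall i, exists2 k : nat, (k <= Y)%N & y i = b + k%:R \/ y i = b - k%:R,
        forall i, y i != 0
      & \sum_i x i / y i = l].
Proof.
move=> W0 W8 cE /andP[H0 Hp] Xp Yp Yc YcH XcH XYH H7 l.
have c0 : (0 < c)%N by rewrite cE muln_gt0.
have [h [u [s [/andP[h0 hH] cuh uH s1 hE]]]] : exists h u : nat, exists s : 'F_p,
    [/\ (0 < h <= H)%N, coprime u h, (u * H < p)%N, s = 1 \/ s = -1
      & h%:R * b = s * u%:R].
  by apply: (Fp_dirichlet_coprime p_pr); rewrite H0.
have ss1 : s * s = 1 by case: s1 => ->; rewrite ?mulr1 // mulrNN mulr1.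
have X0 : (0 < X)%N by apply: leq_trans XcH; rewrite !muln_gt0 H0 c0.
have [G [t [z [/andP[G0 GY] tY zE czh zX]]]] : exists G t z : nat,
    [/\ (0 < G <= Y)%N, (t + G * c <= Y)%N, (u + h * t = G * z)%N, coprime z h
      & forall s, (s <= c)%N ->
          (16 * (z + h * s) < X)%N /\ (minn X Y <= 64 * (z + h * s))%N].
  apply: small_progression => //.
  - by apply: leq_trans YcH; rewrite leq_mul2l hH orbT.
  - rewrite -(leq_pmul2r H0); apply: leq_trans XYH.
    by rewrite -mulnA leq_mul2l (ltnW uH) orbT.
  - by apply: leq_trans XcH; rewrite leq_mul2l hH orbT.
have z0 : (0 < z)%N.
  have [_] := zX 0%N (leq0n _); rewrite muln0 addn0.
  have : (0 < minn X Y)%N by rewrite leq_min X0 (leq_trans G0).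
  by lia.
have [s0 s0W cop] := pairwise_coprime_progression W0 W8 z0 czh.
pose w i := (z + h * (s0 + W * i))%N.
have sc i : (i < 8)%N -> (s0 + W * i <= c)%N.
  move=> i8; rewrite cE [(8 * _)%N]mulnC [X in (_ <= X)%N](mulnS _ 7) leq_add //.
  by rewrite leq_mul2l -ltnS i8 orbT.
have wX i : (i < 8)%N -> (16 * w i < X)%N by move=> /sc /zX[].
have HXY : (64 * H <= minn X Y)%N.
  by rewrite leq_min; apply/andP; split; [apply: leq_trans XcH|apply: leq_trans YcH];
    rewrite leq_mul2r; apply/orP; right; lia.
have wH i : (i < 8)%N -> (H <= w i)%N.
  by move=> /sc /zX[_ le]; rewrite -(@leq_pmul2l 64) //; apply: leq_trans le.
have wF i : (i < 8)%N -> (w i)%:R != 0 :> 'F_p.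
  move=> i8; apply: natf_Fp_neq0 => //; have := wH i i8; have := wX i i8; lia.
have hF : h%:R != 0 :> 'F_p by apply: natf_Fp_neq0 => //; lia.
have GF : G%:R != 0 :> 'F_p by apply: natf_Fp_neq0 => //; lia.
pose ti i := (t + G * (s0 + W * i))%N.
have tiY i : (i < 8)%N -> (ti i <= Y)%N.
  by move=> /sc le; apply: leq_trans tY; rewrite leq_add2l leq_mul2l le orbT.
pose y (i : 'I_8) : 'F_p := b + s * (ti i)%:R.
have yE i : y i = s * G%:R * (w i)%:R / h%:R.
  apply: (mulfI hF); rewrite mulrCA divff // mulr1 -mulrA -natrM.
  rewrite /y mulrDr hE mulrCA -mulrDr -natrM -natrD; congr (_ * _%:R).
  by rewrite /ti /w !mulnDr addnA zE; ring.
have sF : s != 0 by case: s1 => ->; rewrite ?oppr_eq0 oner_eq0.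
pose zs := [seq w i | i <- iota 0 8].
have zsn i : (i < 8)%N -> nth 0%N zs i = w i.
  by move=> i8; rewrite (nth_map 0%N) ?size_iota // nth_iota.
pose Z := (\prod_(x <- zs) x)%N.
pose M := (\prod_(x <- [seq w i | i <- iota 1 7]) x)%N.
have ZM : Z = (w 0%N * M)%N by rewrite /Z /zs big_cons.
have MH : (H ^ 7 <= M)%N.
  have prod_ge ws : all (fun x => H <= x)%N ws -> (H ^ size ws <= \prod_(x <- ws) x)%N.
    elim: ws => [|v ws IH] /=; first by rewrite big_nil.
    by case/andP=> vH /IH wsH; rewrite big_cons expnS leq_mul.
  by apply: (prod_ge [seq w i | i <- iota 1 7]); rewrite /= !wH.
have ZF : Z%:R != 0 :> 'F_p.
  rewrite natr_prod prodf_seq_neq0; apply/allP => x /mapP[i]; rewrite mem_iota.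
  by move=> /andP[_ i8] ->; apply: wF.
pose mu : 'F_p := l * (s * G%:R / h%:R) - a * \sum_(i < 8) (w i)%:R^-1.
(* The representative of [mu * Z] in [[8 * Z, 8 * Z + p)], large enough for [sum_fractions_repr]. *)
pose n := (8 * Z + val ((mu * Z%:R - (8 * Z)%:R)%R : 'F_p))%N.
have nE : n%:R = mu * Z%:R :> 'F_p by rewrite natrD natr_Zp addrC subrK.
have n_lt : (n < 8 * Z + p)%N by rewrite ltn_add2l Fp_val_ltn.
have [|||ss [q [ss_lt q_le qE]]] := @sum_fractions_repr 'F_p zs n.
- apply/(pairwiseP 0%N) => i j; rewrite !inE size_map size_iota => i8 j8 ij.
  by rewrite !zsn //; apply: cop; rewrite ij.
- by rewrite all_map; apply/allP => i; rewrite mem_iota /= => i8; apply: wF.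
- by rewrite size_map size_iota leq_addr.
rewrite size_map size_iota -/Z nE mulfK // in ss_lt q_le qE.
(* The integer [q = q * w 0 / w 0] goes into the first numerator. From [q * Z < 8 * Z + p] and
   [M >= H ^ 7], the product [q * w 0] is below [8 * w 0 + X / 4]. *)
pose k (i : nat) := if i == 0%N then (nth 0%N ss 0 + q * w 0%N)%N else nth 0%N ss i.
have kX i : (i < 8)%N -> (k i < X)%N.
  move=> i8; rewrite /k; case: eqP => [_|_]; last first.
    by have := ss_lt i i8; have := wX i i8; rewrite zsn //; lia.
  have s_lt := ss_lt 0%N isT; rewrite zsn // in s_lt.
  have w0 := wX 0%N isT.
  have M0 : (0 < M)%N by apply: leq_trans MH; rewrite expn_gt0 H0.
  have qw : (4 * (q * w 0%N) < 32 * w 0%N + X)%N.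
    rewrite -(ltn_pmul2r M0).
    have le_MX : (H ^ 7 * X <= M * X)%N by rewrite leq_mul2r MH orbT.
    by have := leq_ltn_trans q_le n_lt; rewrite ZM; lia.
  by lia.
exists (fun i : 'I_8 => a + (k i)%:R), y; split.
- by move=> i; exists (k i) => //; apply: kX.
- move=> i; exists (ti i); first exact: tiY.
  by rewrite /y; case: s1 => ->; [left; rewrite mul1r|right; rewrite mulN1r].
- by move=> i; rewrite yE !mulf_neq0 ?invr_eq0 // wF.
have kE : \sum_(i < 8) (k i)%:R / (w i)%:R = mu.
  rewrite qE [LHS]big_ord_recl [X in _ = X + _]big_ord_recl zsn // addrAC.
  rewrite {1}/k eqxx natrD mulrDl natrM mulfK ?wF //; congr (_ + _).
  by apply: eq_bigr => i _; rewrite zsn // ltn_ord.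
transitivity (s * h%:R / G%:R * (\sum_(i < 8) (k i)%:R / (w i)%:R
    + a * \sum_(i < 8) (w i)%:R^-1)).
  rewrite mulr_sumr -big_split /= mulr_sumr; apply: eq_bigr => i _.
  rewrite yE; have := wF i (ltn_ord i) => wi.
  have sV : s^-1 = s by apply: (mulfI sF); rewrite divff.
  by rewrite !invfM invrK sV; field; rewrite GF wi.
rewrite kE /mu subrK; transitivity (l * (s * s)); last by rewrite ss1 mulr1.
by field; rewrite hF GF.
Qed.

(** * Exponential sums over reciprocals *)

Lemma sqr_sum_le (R : numDomainType) (T : finType) (c : T -> R) :
  (forall t, c t \is Num.real) ->
  (\sum_t c t) ^+ 2 <= #|T|%:R * \sum_t c t ^+ 2.
Proof.
move=> c_real; have : 0 <= \sum_s \sum_t (c s - c t) ^+ 2.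
  apply: sumr_ge0 => s _; apply: sumr_ge0 => t _.
  by rewrite real_exprn_even_ge0 // realB.
have -> : \sum_s \sum_t (c s - c t) ^+ 2
    = (#|T|%:R * (\sum_t c t ^+ 2) - (\sum_t c t) ^+ 2) *+ 2.
  transitivity (\sum_s (c s ^+ 2 *+ #|T| - (c s * \sum_t c t) *+ 2 + \sum_t c t ^+ 2)).
    apply: eq_bigr => s _.
    rewrite mulr_sumr -sumr_const -sumrMnl -sumrB -big_split /=.
    by apply: eq_bigr => t _; rewrite sqrrB.
  rewrite big_split /= sumrB !sumrMnl sumr_const -mulr_suml -expr2.
  by rewrite mulrnBl mulr2n mulr_natl addrAC.
by rewrite pmulrn_lge0 // subr_ge0.
Qed.


(** * Additive characters of the prime field and the circle method *)

Section AdditiveCharacter.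
Variables (p : nat) (p_pr : prime p) (w : algC) (w_prim : p.-primitive_root w).

Definition psi (x : 'F_p) : algC := w ^+ (x : nat).

Lemma psi_nat (n : nat) : psi n%:R = w ^+ n.
Proof. by rewrite /psi val_Fp_nat // prim_expr_mod. Qed.

Lemma psi0 : psi 0 = 1. Proof. by []. Qed.

Lemma psiD (x y : 'F_p) : psi (x + y) = psi x * psi y.
Proof. by rewrite -{1}(natr_Zp x) -{1}(natr_Zp y) -natrD psi_nat exprD. Qed.

Lemma psi_sum (T : finType) (f : T -> 'F_p) : psi (\sum_t f t) = \prod_t psi (f t).
Proof. exact: (big_morph psi psiD psi0). Qed.

Lemma norm_psi (x : 'F_p) : `|psi x| = 1.
Proof.
rewrite normrX; suff -> : `|w| = 1 by rewrite expr1n.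
apply/eqP; rewrite -(@pexpr_eq1 _ _ p) ?prime_gt0 //.
by rewrite -normrX prim_expr_order // normr1.
Qed.

Lemma conj_psi (x : 'F_p) : (psi x)^* = psi (- x).
Proof.
have px0 : psi x != 0 by rewrite -normr_eq0 norm_psi oner_eq0.
apply: (mulfI px0); rewrite -normCK norm_psi expr1n.
by rewrite -psiD subrr psi0.
Qed.

Lemma psi_eq1 (x : 'F_p) : psi x = 1 -> x = 0.
Proof.
move=> /eqP; rewrite -(prim_order_dvd w_prim) => px; apply: val_inj => /=.
by move: px (Fp_val_ltn p_pr x) => /=; case: (nat_of_ord x) => [|m] //= /dvdn_leq; lia.
Qed.

Lemma sum_psi (a : 'F_p) : \sum_(x : 'F_p) psi (x * a) = (p * (a == 0))%:R.
Proof.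
case: eqP => [->|/eqP a0].
  under eq_bigr do rewrite mulr0 psi0.
  by rewrite sumr_const card_Fp // muln1.
rewrite muln0; set s := \sum_x _.
have sE : psi a * s = s.
  rewrite mulr_sumr [RHS](reindex_inj (addrI 1)); apply: eq_bigr => x _.
  by rewrite -psiD mulrDl mul1r.
apply/eqP; move/eqP: sE; rewrite -subr_eq0 -{2}[s]mul1r -mulrBl mulf_eq0 subr_eq0.
by case/orP=> // /eqP /psi_eq1 /eqP; rewrite (negPf a0).
Qed.

Definition expsum (T : finType) (f : T -> 'F_p) (a : 'F_p) : algC :=
  \sum_t psi (a * f t).

Lemma expsum0 (T : finType) (f : T -> 'F_p) : expsum f 0 = #|T|%:R.
Proof.
rewrite /expsum; under eq_bigr do rewrite mul0r psi0.
by rewrite sumr_const.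
Qed.

Lemma norm_expsum_le (T : finType) (f : T -> 'F_p) a : `|expsum f a| <= #|T|%:R.
Proof.
apply: le_trans (ler_norm_sum _ _ _) _; rewrite -sumr_const.
by apply: ler_sum => t _; rewrite norm_psi.
Qed.

Lemma sqr_norm_expsum (T : finType) (f : T -> 'F_p) a :
  `|expsum f a| ^+ 2 = \sum_s \sum_t psi (a * (f s - f t)).
Proof.
rewrite normCK rmorph_sum mulr_suml; apply: eq_bigr => s _.
rewrite mulr_sumr; apply: eq_bigr => t _.
by rewrite /= conj_psi -psiD mulrBr.
Qed.

(** Parseval: orthogonality leaves only the pairs on which [f] agrees. *)
Lemma sum_sqr_norm_expsum (T : finType) (f : T -> 'F_p) :
  \sum_a `|expsum f a| ^+ 2 = (p * #|[set st : T * T | f st.1 == f st.2]|)%:R.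
Proof.
under eq_bigr do rewrite sqr_norm_expsum pair_bigA.
rewrite exchange_big /=.
rewrite (eq_bigr _ (fun st _ => sum_psi (f st.1 - f st.2))).
rewrite -natr_sum -big_distrr /=; congr (_ * _)%:R.
rewrite -sum1_card [RHS]big_mkcond /=; apply: eq_bigr => st _.
by rewrite inE subr_eq0; case: eqP.
Qed.

(** Up to the factor [p], the sum over [a] of [psi (- a * l) * S(a) ^ m] counts the representations
    of [l]. Were there none, the other terms would have to cancel the term [#|T| ^ m] at [a = 0],
    and they are too small. *)
Lemma expsum_cover (m : nat) (T : finType) (f : T -> 'F_p) :
  \sum_(a | a != 0) `|expsum f a| ^+ m < #|T|%:R ^+ m ->
  forall l : 'F_p, exists t : 'I_m -> T, \sum_i f (t i) = l.
Proof.
move=> small l.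
case: (boolP [exists g : {ffun 'I_m -> T}, \sum_i f (g i) == l]).
  by case/existsP=> g /eqP gl; exists g.
rewrite negb_exists => /forallP none; exfalso.
have : \sum_a psi (a * - l) * expsum f a ^+ m = 0.
  transitivity (\sum_a \sum_(g : {ffun 'I_m -> T}) psi (a * (\sum_i f (g i) - l))).
    apply: eq_bigr => a _.
    rewrite -[m in _ ^+ m]card_ord -prodr_const bigA_distr_bigA mulr_sumr.
    apply: eq_bigr => g _; rewrite -psi_sum -psiD; congr psi.
    by rewrite mulrBr mulr_sumr mulrN addrC.
  rewrite exchange_big big1 //= => g _; rewrite sum_psi subr_eq0.
  by rewrite (negPf (none g)) muln0.
rewrite (bigD1 0) //= mul0r psi0 mul1r expsum0 => /eqP; rewrite addr_eq0 => /eqP E.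
have : `|#|T|%:R ^+ m| <= \sum_(a | a != 0) `|expsum f a| ^+ m.
  rewrite E normrN; apply: le_trans (ler_norm_sum _ _ _) _.
  by apply: ler_sum => a _; rewrite normrM norm_psi mul1r normrX.
by rewrite normrX normr_nat => /le_lt_trans/(_ small); rewrite ltxx.
Qed.
End AdditiveCharacter.

Lemma sum_inj_le (R : numDomainType) (T U : finType) (h : T -> U) (F : U -> R) :
  injective h -> (forall u, 0 <= F u) -> \sum_t F (h t) <= \sum_u F u.
Proof.
move=> h_inj F0.
have <- : \sum_(u in h @: T) F u = \sum_t F (h t) by rewrite big_imset //; apply: in2W.
by rewrite [leRHS](bigID (mem (h @: T))) /= lerDl sumr_ge0.
Qed.

(** * A fourth-power bound for sums over reciprocals *)

Section ReciprocalSums.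
Variables (p : nat) (p_pr : prime p) (w : algC) (w_prim : p.-primitive_root w).
Local Notation psi := (psi w).

(** Equal to [1 / (t * (t + 1))] away from the poles [0] and [- 1]. *)
Definition recdiff (t : 'F_p) : 'F_p := t^-1 - (t + 1)^-1.

(** Away from the poles the equation reduces to [(s - t) * (s + t + 1) = 0], which gives two lines.
    Poles in [s] or in [t] give four more, and each line has at most [p] points. *)
Lemma card_recdiff :
  (#|[set st : 'F_p * 'F_p | recdiff st.1 == recdiff st.2]| <= 6 * p)%N.
Proof.
pose im (h : 'F_p -> 'F_p * 'F_p) := [set h t | t : 'F_p].
have im_le h : (#|im h| <= p)%N.
  by apply: leq_trans (leq_imset_card _ _) _; rewrite card_Fp.
pose A := im (fun t => (t, t)) :|: (im (fun t => (t, - 1 - t)) :|: (im (fun t => (0, t))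
  :|: (im (fun t => (- 1, t)) :|: (im (fun t => (t, 0)) :|: im (fun t => (t, - 1)))))).
apply: (@leq_trans #|A|).
  apply/subset_leq_card/subsetP => -[s t]; rewrite inE /= /recdiff => /eqP E.
  have imP h r : h r = (s, t) -> (s, t) \in im h by move=> <-; apply: imset_f.
  rewrite !in_setU.
  have [s0|s0] := eqVneq s 0; first by rewrite (imP (fun t => (0, t)) t) ?s0 ?orbT.
  have [s1|s1] := eqVneq s (-1); first by rewrite (imP (fun t => (-1, t)) t) ?s1 ?orbT.
  have [t0|t0] := eqVneq t 0; first by rewrite (imP (fun t => (t, 0)) s) ?t0 ?orbT.
  have [t1|t1] := eqVneq t (-1); first by rewrite (imP (fun t => (t, -1)) s) ?t1 ?orbT.
  have s2 : s + 1 != 0 by rewrite addr_eq0.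
  have t2 : t + 1 != 0 by rewrite addr_eq0.
  have : (s - t) * (s + t + 1) = 0.
    transitivity (s * (s + 1) * (t * (t + 1)) *
       ((t^-1 - (t + 1)^-1) - (s^-1 - (s + 1)^-1))); last by rewrite E subrr mulr0.
    by field; rewrite s0 s2 t0 t2.
  move/eqP; rewrite mulf_eq0 subr_eq0 => /orP[/eqP st|/eqP st].
    by rewrite (imP (fun t => (t, t)) s) // st.
  rewrite (imP (fun t => (t, -1 - t)) s) ?orbT //; congr (_, _).
  by apply/eqP; rewrite -subr_eq0 -oppr_eq0 -st; apply/eqP; ring.
do 5! [apply: leq_trans (leq_card_setU _ _) _; rewrite mulSn leq_add //].
by rewrite mul1n.
Qed.

Variable n : nat.
Hypothesis n_le : (n <= p)%N.

(** Two shifts give a bilinear structure: [j] gets completed to the field, [d] gets differenced. A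
    zero denominator yields [0]. *)
Definition sum_reciprocal (b : 'F_p) (jd : 'I_n * 'I_n) : 'F_p :=
  (b + (jd.1 : nat)%:R + (jd.2 : nat)%:R)^-1.

Lemma ord_Fp_inj : injective (fun i : 'I_n => (i : nat)%:R : 'F_p).
Proof.
move=> i j /(congr1 val) /=; rewrite !val_Fp_nat // !modn_small ?(leq_trans (ltn_ord _)) //.
exact: val_inj.
Qed.

(** The substitution [y = (e - d) * t - d] turns [y + d] and [y + e] into [t] and [t + 1] times
    [e - d]. *)
Lemma sum_psi_recdiff (a d e : 'F_p) :
  \sum_y psi (a * ((y + d)^-1 - (y + e)^-1)) = expsum w recdiff (a / (e - d)).
Proof.
(* For [e = d] both sides are [p], because [a / 0 = 0]. *)
have [->|ed] := eqVneq e d.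
  rewrite subrr invr0 mulr0 expsum0 card_Fp //.
  under eq_bigr do rewrite subrr mulr0 psi0.
  by rewrite sumr_const card_Fp.
have ed0 : e - d != 0 by rewrite subr_eq0.
rewrite (reindex_inj (addIr (- d))) (reindex_inj (mulfI ed0)) /=.
apply: eq_bigr => t _; congr psi; rewrite subrK.
have -> : (e - d) * t - d + e = (e - d) * (t + 1) by ring.
by rewrite !invfM -mulrBr mulrA.
Qed.

(** Expand the square and apply Cauchy-Schwarz over the [n ^ 2] pairs [(d, e)]. For fixed [d] the
    map from [e] to [a / (e - d)] is injective, so Parseval and [card_recdiff] bound each inner sum
    by [6 * p ^ 2]. *)
Lemma sum_shifted_reciprocals (a : 'F_p) : a != 0 ->
  (\sum_y `|\sum_(d < n) psi (a * (y + (d : nat)%:R)^-1)| ^+ 2) ^+ 2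
    <= (6 * n ^ 3 * p ^ 2)%:R :> algC.
Proof.
move=> a0; pose g (de : 'I_n * 'I_n) : algC :=
  expsum w recdiff (a / ((de.2 : nat)%:R - (de.1 : nat)%:R)).
set V := \sum_y _.
have VE : V = \sum_de g de.
  transitivity (\sum_(y : 'F_p) \sum_(de : 'I_n * 'I_n)
      psi (a * ((y + (de.1 : nat)%:R)^-1 - (y + (de.2 : nat)%:R)^-1))).
    apply: eq_bigr => y _.
    by rewrite (sqr_norm_expsum p_pr w_prim (fun d : 'I_n => (y + (d : nat)%:R)^-1)) pair_bigA.
  by rewrite exchange_big; apply: eq_bigr => de _; rewrite sum_psi_recdiff.
have V0 : 0 <= V by apply: sumr_ge0 => y _; rewrite exprn_ge0.
have Vg : V <= \sum_de `|g de|.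
  by rewrite -(ger0_norm V0) VE ler_norm_sum.
apply: le_trans (_ : (\sum_de `|g de|) ^+ 2 <= _); first by rewrite lerXn2r ?nnegrE // sumr_ge0.
apply: le_trans (sqr_sum_le _) _ => [de|]; first exact: normr_real.
rewrite card_prod !card_ord.
have -> : (6 * n ^ 3 * p ^ 2 = n * n * (n * (p * (6 * p))))%N by ring.
rewrite [leRHS]natrM ler_wpM2l //.
rewrite -(pair_bigA _ (fun d e => `|g (d, e)| ^+ 2)) natrM.
rewrite mulr_natl -[n in leRHS]card_ord -sumr_const; apply: ler_sum => d _.
apply: le_trans (_ : \sum_b `|expsum w recdiff b| ^+ 2 <= _).
  apply: (@sum_inj_le _ _ _ (fun e : 'I_n => a / ((e : nat)%:R - (d : nat)%:R))
     (fun b => `|expsum w recdiff b| ^+ 2)) => [e e' /(mulfI a0) /invr_inj /addIr|b].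
    exact: ord_Fp_inj.
  by rewrite exprn_ge0.
by rewrite sum_sqr_norm_expsum // ler_nat leq_mul2l card_recdiff orbT.
Qed.

(** Cauchy-Schwarz in [j], then completion of [b + j] to all of ['F_p], reduces this to
    [sum_shifted_reciprocals]. *)
Lemma expsum_reciprocals_le (a b : 'F_p) : a != 0 ->
  `|expsum w (sum_reciprocal b) a| ^+ 4 <= (6 * n ^ 5 * p ^ 2)%:R.
Proof.
move=> a0; pose c (y : 'F_p) : algC := \sum_(d < n) psi (a * (y + (d : nat)%:R)^-1).
set S := expsum _ _ _.
have SE : S = \sum_(j < n) c (b + (j : nat)%:R).
  by rewrite /S /expsum -(pair_bigA _ (fun j d : 'I_n =>
    psi (a * (b + (j : nat)%:R + (d : nat)%:R)^-1))).
have S2 : `|S| ^+ 2 <= n%:R * \sum_y `|c y| ^+ 2.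
  apply: le_trans (_ : (\sum_(j < n) `|c (b + (j : nat)%:R)|) ^+ 2 <= _).
    by rewrite SE lerXn2r ?nnegrE ?ler_norm_sum // sumr_ge0.
  apply: le_trans (sqr_sum_le _) _ => [j|]; first exact: normr_real.
  rewrite card_ord ler_wpM2l //.
  apply: (@sum_inj_le _ _ _ (fun j : 'I_n => b + (j : nat)%:R) (fun y => `|c y| ^+ 2)).
    by move=> i j /addrI; apply: ord_Fp_inj.
  by move=> y; rewrite exprn_ge0.
rewrite (exprM _ 2 2).
apply: le_trans (_ : (n%:R * \sum_y `|c y| ^+ 2) ^+ 2 <= _).
  by rewrite lerXn2r ?nnegrE ?mulr_ge0 ?exprn_ge0 ?sumr_ge0 // => y _; rewrite exprn_ge0.
have -> : (6 * n ^ 5 * p ^ 2 = n ^ 2 * (6 * n ^ 3 * p ^ 2))%N by ring.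
rewrite exprMn natrM natrX ler_wpM2l ?exprn_ge0 //.
exact: sum_shifted_reciprocals.
Qed.

(** Inversion is injective, also at [0], so three of the four shifts determine the last. *)
Lemma card_reciprocals_eq (b : 'F_p) :
  (#|[set st : ('I_n * 'I_n) * ('I_n * 'I_n)
       | sum_reciprocal b st.1 == sum_reciprocal b st.2]| <= n ^ 3)%N.
Proof.
pose h (st : ('I_n * 'I_n) * ('I_n * 'I_n)) := (st.1, st.2.1).
have -> : (n ^ 3 = #|{: ('I_n * 'I_n) * 'I_n}|)%N by rewrite !card_prod !card_ord; ring.
rewrite -(@card_in_imset _ _ h) ?max_card //.
move=> [[j d] [j' d']] [[k e] [k' e']]; rewrite !inE /sum_reciprocal /=.
move=> /eqP /invr_inj E1 /eqP /invr_inj E2 [kj ed kj'].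
move: E1; rewrite kj ed kj' E2 => /addrI /ord_Fp_inj.
by move=> ->.
Qed.

End ReciprocalSums.

(** Of eight factors, four are bounded by [expsum_reciprocals_le], two trivially by [n ^ 2] each,
    and two are averaged by Parseval, contributing [p * n ^ 3]. The total [6 * n ^ 12 * p ^ 3] is
    below [n ^ 16]. *)
Lemma reciprocals_cover (p n : nat) (b : 'F_p) : prime p -> (n <= p)%N ->
  (6 * p ^ 3 < n ^ 4)%N ->
  forall l : 'F_p, exists t : 'I_8 -> 'I_n * 'I_n,
    \sum_i (b + ((t i).1 : nat)%:R + ((t i).2 : nat)%:R)^-1 = l.
Proof.
move=> p_pr n_le np; have [w w_prim] := C_prim_root_exists (prime_gt0 p_pr).
pose f := @sum_reciprocal p n b.
apply: (expsum_cover p_pr w_prim (f := f)).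
have n0 : (0 < n)%N by case: (n) np.
rewrite card_prod !card_ord -natrX.
apply: le_lt_trans (_ : (6 * n ^ 5 * p ^ 2 * (n * n) ^ 2 * (p * n ^ 3))%:R < _).
  apply: le_trans (_ : \sum_(a | a != 0) (6 * n ^ 5 * p ^ 2 * (n * n) ^ 2)%:R
      * `|expsum w f a| ^+ 2 <= _).
    apply: ler_sum => a a0; rewrite (exprD _ 6 2) (exprD _ 4 2) natrM.
    rewrite ler_wpM2r ?exprn_ge0 // ler_pM ?exprn_ge0 //.
      exact: expsum_reciprocals_le.
    rewrite natrX lerXn2r ?nnegrE // (le_trans (norm_expsum_le p_pr w_prim _ _)) //.
    by rewrite card_prod card_ord.
  rewrite -mulr_sumr [leRHS]natrM ler_wpM2l //.
  apply: le_trans (_ : \sum_a `|expsum w f a| ^+ 2 <= _).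
    by rewrite [leRHS](bigID (fun a => a != 0)) /= lerDl sumr_ge0 // => a _; rewrite exprn_ge0.
  by rewrite sum_sqr_norm_expsum // ler_nat leq_mul2l card_reciprocals_eq ?orbT.
rewrite ltr_nat.
have -> : (6 * n ^ 5 * p ^ 2 * (n * n) ^ 2 * (p * n ^ 3) = n ^ 12 * (6 * p ^ 3))%N by ring.
have -> : ((n * n) ^ 8 = n ^ 12 * n ^ 4)%N by ring.
by rewrite ltn_pmul2l // expn_gt0 n0.
Qed.

(** * The two ranges of numerators *)

Lemma Fp_intervalP (p : nat) (A : {set 'F_p}) : prime p -> Fp_interval A ->
  exists a : 'F_p, [/\ (0 < #|A| <= p)%N
    & forall k : nat, (k < #|A|)%N -> a + k%:R \in A].
Proof.
move=> p_pr [a [N [/andP[N1 Np] AE]]]; exists a.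
have cA : #|A| = N.
  rewrite AE card_imset ?card_ord // => i j /addrI.
  exact: (ord_Fp_inj p_pr Np).
rewrite cA N1; split=> // k kN; rewrite AE.
by apply/imsetP; exists (Ordinal kN).
Qed.

Lemma fractions_cover_large_numerators : exists K : nat,
  forall (p : nat) (I J : {set 'F_p}), prime p -> Fp_interval I -> Fp_interval J ->
  (K * p <= #|I| ^ 2 * #|J|)%N -> (K * p <= #|I| * #|J| ^ 2)%N -> (K * p <= #|I| ^ 8)%N ->
  forall l : 'F_p, exists x y : 'I_8 -> 'F_p,
    [/\ forall i, x i \in I, forall i, y i \in J, forall i, y i <> 0
      & \sum_(i < 8) x i / y i = l].
Proof.
have [W W0 W8] : exists2 W, (0 < W)%N & forall i, (0 < i < 8)%N -> (i %| W)%N.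
  by exists 7`!; [exact: fact_gt0 | move=> i /andP[i0 i8]; apply: dvdn_fact; lia].
have [c cE] : exists c, c = (8 * W)%N by eexists.
have [D DE] : exists D, D = (1024 * c)%N by eexists.
(* The three summands serve in turn for [D <= X] and [D <= Y], for [256 * c * p <= X * Y1 * H], and
   for [4 * p <= H ^ 7 * X]. *)
exists (D ^ 2 + 2048 * D * c + 4 * (2 * D) ^ 7)%N.
set K := (_ + _ + _)%N.
have [K1 K2 K3] : [/\ (D ^ 2 <= K)%N, (2048 * D * c <= K)%N & (4 * (2 * D) ^ 7 <= K)%N].
  split; last exact: leq_addl.
    exact: leq_trans (leq_addr _ _) (leq_addr _ _).
  exact: leq_trans (leq_addl _ _) (leq_addr _ _).
move: K K1 K2 K3 => K K1 K2 K3.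
have D0 : (1024 <= D)%N by clear -DE cE W0; lia.
move=> p I J p_pr /(Fp_intervalP p_pr)[a []] + Ia /(Fp_intervalP p_pr)[b []] + Jb.
move: #|I| #|J| Ia Jb => X Y Ia Jb /andP[X0 Xp] /andP[Y0 Yp] KX KY K8 l.
have p0 := prime_gt0 p_pr.
have DX : (D <= X)%N.
  rewrite -leq_sqr; apply: leq_trans K1 _; rewrite -(leq_pmul2r p0).
  by apply: leq_trans KX _; rewrite leq_mul2l Yp orbT.
have DY : (D <= Y)%N.
  rewrite -leq_sqr; apply: leq_trans K1 _; rewrite -(leq_pmul2r p0).
  by apply: leq_trans KY _; rewrite mulnC leq_mul2l Xp orbT.
have [A [AX AY DA AE]] : exists A, [/\ (A <= X)%N, (A <= Y)%N, (D <= A)%N & A = X \/ A = Y].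
  exists (minn X Y); rewrite geq_minl geq_minr leq_min DX DY; split=> //.
  by rewrite /minn; case: ifP; [left|right].
have KA : (K * p <= X * Y * A)%N by case: AE => ->; [apply: leq_trans KX _|apply: leq_trans KY _];
  rewrite expnS expn1; clear; lia.
(* For [A = X] this is the bound on [X ^ 8]; for [A = Y] it follows from the bound on
   [X * Y ^ 2]. *)
have K7 : (K * p <= A ^ 7 * X)%N.
  case: AE => ->; first by rewrite -expnSr.
  apply: leq_trans KY _; rewrite mulnC leq_mul2r; apply/orP; right.
  by rewrite leq_pexp2l.
have [H HE] : exists H, H = (A %/ D)%N by eexists.
have Dp : (0 < D)%N by exact: leq_trans D0.
have H1 : (0 < H)%N by rewrite HE divn_gt0.
have H2 : (D * H <= A)%N by rewrite HE mulnC leq_divM.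
have H3 : (A <= 2 * D * H)%N.
  have := ltn_ceil A Dp; rewrite -HE mulSn mulnC => /ltnW /leq_trans; apply.
  by rewrite -mulnA mul2n -addnn leq_add2r leq_pmulr.
(* The radius [Y1] around [b + Y1] stays inside [J] in both directions. *)
have [Y1 [Y1a Y1b]] : exists Y1, (2 * Y1 < Y)%N /\ (Y <= 4 * Y1)%N.
  by exists (Y.-1./2); have := odd_double_half Y.-1; clear -D0 DY; lia.
have cH : (1024 * c * H <= A)%N by rewrite -DE.
have [x [y [xI yJ y0 xyl]]] : exists x y : 'I_8 -> 'F_p,
    [/\ forall i, exists2 k : nat, (k < X)%N & x i = a + k%:R,
        forall i, exists2 k : nat, (k <= Y1)%N & y i = b + Y1%:R + k%:R \/ y i = b + Y1%:R - k%:R,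
        forall i, y i != 0
      & \sum_i x i / y i = l].
  refine (@fractions_cover p p_pr a (b + Y1%:R) W c X Y1 H W0 W8 cE _ _ _ _ _ _ _ _ l).
  - rewrite H1 /=; apply: leq_trans Xp; apply: leq_trans AX; apply: leq_trans H2.
    by rewrite ltn_Pmull // (leq_trans _ D0).
  - by [].
  - by clear -Y1a Yp; lia.
  - by clear -DE DY Y1b; lia.
  - by clear -cH AY Y1b; lia.
  - by clear -cH AX; lia.
  - rewrite -(@leq_pmul2l (8 * D)); last by clear -Dp; lia.
    apply: (@leq_trans (X * Y * A)).
      by apply: leq_trans KA; apply: leq_trans (leq_mul K2 (leqnn p)); clear; lia.
    apply: (@leq_trans (X * (4 * Y1) * (2 * D * H))); last by clear; lia.
    by rewrite !leq_mul.
  - have D7 : (0 < (2 * D) ^ 7)%N by rewrite expn_gt0 muln_gt0 Dp.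
    rewrite -(leq_pmul2l D7) [X in (_ <= X)%N]mulnA -expnMn.
    apply: (@leq_trans (A ^ 7 * X)); last by rewrite leq_mul2r leq_exp2r // H3 orbT.
    by apply: leq_trans K7; apply: leq_trans (leq_mul K3 (leqnn p)); rewrite mulnCA mulnA.
exists x, y; split=> // i.
- by have [k kX ->] := xI i; apply: Ia.
- have [k kY [->|->]] := yJ i.
    by rewrite -addrA -natrD; apply: Jb; clear -kY Y1a; lia.
  by rewrite -addrA -natrB //; apply: Jb; clear -kY Y1a; lia.
- exact/eqP.
Qed.

(** All numerators equal one nonzero [x0], so reciprocals must sum to [l / x0]. The factor [8 ^ 4]
    pays for the choice of [n] with [Y <= 8 * n]. *)
Lemma fractions_cover_large_denominators (p : nat) (I J : {set 'F_p}) :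
  prime p -> nonzero_Fp_interval I -> Fp_interval J ->
  (6 * 8 ^ 4 * p ^ 3 < #|J| ^ 4)%N ->
  forall l : 'F_p, exists x y : 'I_8 -> 'F_p,
    [/\ forall i, x i \in I, forall i, y i \in J, forall i, y i <> 0
      & \sum_(i < 8) x i / y i = l].
Proof.
move=> p_pr [/(Fp_intervalP p_pr)[a [/andP[I0 _] _]] IN0].
move=> /(Fp_intervalP p_pr)[b [/andP[_ Yp] Jb]] pY l.
have [x0 x0I x0N] : exists2 x, x \in I & x != 0.
  case: (set_0Vmem (I :\ 0)) => [/eqP|[x]]; last by rewrite !inE => /andP[]; exists x.
  rewrite setD_eq0 subset1 => /orP[/eqP //|/eqP IE].
  by rewrite IE cards0 in I0.
move: #|J| Jb Yp pY => Y Jb Yp pY.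
have p2 := prime_gt1 p_pr.
have Y4 : (4 <= Y)%N.
  rewrite leqNgt; apply/negP => Y4; move: pY; apply/negP; rewrite -leqNgt.
  apply: (@leq_trans (4 ^ 4)); first by rewrite leq_exp2r // ltnW.
  apply: (@leq_trans (6 * 8 ^ 4)) => //.
  by rewrite leq_pmulr // expn_gt0 (ltnW p2).
have [n [n4 n8]] : exists n, (4 * n <= Y)%N /\ (Y <= 8 * n)%N.
  by exists (Y %/ 4)%N; have := divn_eq Y 4; have := ltn_mod Y 4; clear -Y4; lia.
have np : (6 * p ^ 3 < n ^ 4)%N.
  rewrite -(@ltn_pmul2l (8 ^ 4)) // mulnCA mulnA; apply: leq_trans pY _.
  by rewrite -expnMn leq_exp2r.
(* A run of [2 * n - 1] elements of [J] avoiding [0]: as [4 * n <= Y <= p], a zero in the first run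
   excludes one in the run starting [2 * n] later. *)
have [b' b'J b'N] : exists2 b' : 'F_p,
    (forall k, (k < (2 * n).-1)%N -> b' + k%:R \in J) &
    (forall k, (k < (2 * n).-1)%N -> b' + k%:R != 0).
  case: (boolP [exists k : 'I_(2 * n).-1, b + (k : nat)%:R == 0]); last first.
    rewrite negb_exists => /forallP bN; exists b => k kn.
      by apply: Jb; clear -kn n4; lia.
    exact: (bN (Ordinal kn)).
  case/existsP=> k /eqP bk; exists (b + (2 * n)%:R) => j jn.
    by rewrite -addrA -natrD; apply: Jb; clear -jn n4; lia.
  have kn := ltn_ord k.
  have -> : b + (2 * n)%:R + j%:R = (2 * n + j - k)%:R :> 'F_p.
    rewrite natrB; last by clear -kn; lia.
    by rewrite natrD -[LHS]subr0 -bk; ring.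
  by apply: natf_Fp_neq0 => //; clear -kn jn n4 Yp; lia.
have [t tl] : exists t : 'I_8 -> 'I_n * 'I_n,
    \sum_i (b' + ((t i).1 : nat)%:R + ((t i).2 : nat)%:R)^-1 = l / x0.
  by apply: reciprocals_cover => //; clear -n4 Yp; lia.
have tn i : ((t i).1 + (t i).2 < (2 * n).-1)%N.
  by have := ltn_ord (t i).1; have := ltn_ord (t i).2; clear; lia.
exists (fun=> x0), (fun i => b' + ((t i).1 : nat)%:R + ((t i).2 : nat)%:R); split=> //.
- by move=> i; rewrite -addrA -natrD b'J.
- by move=> i; apply/eqP; rewrite -addrA -natrD b'N.
- by rewrite -mulr_sumr tl mulrCA divff // mulr1.
Qed.

Theorem theorem1 (R : realType) (eps : R) (heps : 0 < eps) :
  exists p0 : nat, forall p : nat, prime p -> (p0 < p)%N ->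
  forall I J : {set 'F_p},
    nonzero_Fp_interval I -> nonzero_Fp_interval J ->
    powR (p%:R : R) (1 + eps) < (#|I|)%:R ^+ 2 * (#|J|)%:R ->
    powR (p%:R : R) (1 + eps) < (#|I|)%:R * (#|J|)%:R ^+ 2 ->
  forall lambda : 'F_p,
    exists x y : 'I_8 -> 'F_p,
      [/\ forall i, x i \in I,
          forall i, y i \in J,
          forall i, y i <> 0
        & \sum_(i < 8) x i / y i = lambda].
Proof.
have [K coverA] := fractions_cover_large_numerators.
have [q qE] : exists q, q = (6 * 8 ^ 4)%N by eexists.
have q0 : (0 < q)%N by rewrite qE.
(* For [p] above this bound, [p ^ eps >= L]. *)
pose L := (q + K)%N; exists (Num.bound (powR (L%:R : R) eps^-1)).
move=> p p_pr p_gt I J hI hJ; have p0 := prime_gt0 p_pr.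
have Lp : (L * p)%:R <= powR (p%:R : R) (1 + eps).
  rewrite powRD; last by rewrite pnatr_eq0 -lt0n p0 implybT.
  rewrite powRr1 // natrM mulrC ler_wpM2l //.
  have -> : L%:R = powR (powR (L%:R : R) eps^-1) eps.
    by rewrite -powRrM mulVf ?gt_eqF // powRr1.
  rewrite ge0_ler_powR ?nnegrE ?powR_ge0 // ?ltW //.
  by apply: lt_trans (archi_boundP (powR_ge0 _ _)) _; rewrite ltr_nat.
move=> /(le_lt_trans Lp) + /(le_lt_trans Lp).
rewrite -natrX -natrM ltr_nat => LX; rewrite -natrX -natrM ltr_nat => LY.
have KL : (K * p <= L * p)%N by rewrite leq_mul2r leq_addl orbT.
case: (leqP (K * p) (#|I| ^ 8)) => K8.
  by apply: coverA; case: hI hJ => // hI _ [hJ _] //; apply: leq_trans KL _; apply: ltnW.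
apply: fractions_cover_large_denominators => //; first by case: hJ.
rewrite -qE.
have K0 : (0 < K)%N by case: (K) K8.
(* Together with [#|I| ^ 8 < K * p] this gives [L ^ 4 * p ^ 3 < K * #|J| ^ 4], and [K * q <= L ^ 4]
   then leaves [q * p ^ 3 < #|J| ^ 4]. *)
have : ((L * p) ^ 4 < (#|I| ^ 2 * #|J|) ^ 4)%N by rewrite ltn_exp2r.
rewrite (expnMn L p) (expnMn (#|I| ^ 2) #|J|) -expnM => lt1.
have : (L ^ 4 * p ^ 4 < K * p * #|J| ^ 4)%N.
  by apply: leq_trans lt1 _; rewrite leq_mul2r (ltnW K8) orbT.
have -> : (L ^ 4 * p ^ 4 = p * (L ^ 4 * p ^ 3))%N by ring.
have -> : (K * p * #|J| ^ 4 = p * (K * #|J| ^ 4))%N by ring.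
rewrite ltn_pmul2l // => lt2; rewrite -(ltn_pmul2l K0).
apply: leq_ltn_trans lt2; rewrite mulnA leq_mul2r; apply/orP; right.
have L1 : (0 < L)%N by rewrite addn_gt0 q0.
rewrite -[4%N]/(2 + 2)%N expnD expnS expn1.
apply: (@leq_trans (L * L)); first by rewrite leq_mul ?leq_addl ?leq_addr.
by rewrite leq_pmulr // muln_gt0 L1.
Qed.
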